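(* Let $m,n$ be positive integers and $k\ge 2$ an integer. Let $P\in\mathbb{R}[x_1,\ldots,x_n]$ be a polynomial that has a zero of multiplicity at least $k$ at every point of $mB^n\setminus\{\mathbf 0\}$ and a zero of multiplicity exactly $l$ at $\mathbf 0$, where $l\ge 0$ is an integer. (i) If $l=k-1$, then $\deg P\ge mn+(m+1)(k-1)$. (ii) If $l\le k-2$, $k\in\{2,3,4\}$ and $n\ge k-1$, then $\deg P\ge mn+(m+1)(k-1)-1$. Moreover both bounds are attained. In case (i) there is such a polynomial with $l=k-1$ and $\deg P=mn+(m+1)(k-1)$. In case (ii), for every $l\in\{0,\ldots,k-2\}$ there is such a polynomial with zero multiplicity exactly $l$ at $\mathbf 0$ and $\deg P=mn+(m+1)(k-1)-1$.
   Context: $mB^n=\{0,1,\ldots,m\}^n\subseteq\mathbb{R}^n$. For a nonzero polynomial $f\in\mathbb{R}[x_1,\ldots,x_n]$ and a point $\mathbf a=(a_1,\ldots,a_n)$, the multiplicity of the zero of $f$ at $\mathbf a$ is the minimum total degree of a monomial occurring in the expansion of $f(x_1+a_1,\ldots,x_n+a_n)$; multiplicity $0$ means $f(\mathbf a)\neq 0$. The zero polynomial has a zero of every multiplicity. Equivalently, $f$ has a zero of multiplicity at least $k$ at $\mathbf a$ if and only if all partial derivatives of $f$ of order less than $k$ vanish at $\mathbf a$. *)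

(* Defs.v *)
From HB Require Import structures.
From mathcomp Require Import all_boot all_order all_algebra.
From mathcomp Require Import mpoly.
From mathcomp Require Import Rstruct.
Set Implicit Arguments. Unset Strict Implicit. Unset Printing Implicit Defensive.
Import GRing.Theory.
Local Open Scope ring_scope.

Notation RR := Rdefinitions.R.

Definition shift_mpoly (n : nat) (P : {mpoly RR[n]}) (a : 'I_n -> RR) : {mpoly RR[n]} :=
  P \mPo [tuple ('X_i + (a i)%:MP) | i < n].

(* f has a zero of multiplicity at least k at a: every monomial occurring in
   f(x + a) has total degree >= k (vacuous for the zero polynomial). *)
Definition mult_ge (n : nat) (P : {mpoly RR[n]}) (a : 'I_n -> RR) (k : nat) : Prop :=
  forall mo, mo \in msupp (shift_mpoly P a) -> (k <= mdeg mo)%N.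

(* f has a zero of multiplicity exactly l at a
   (the minimum total degree of a monomial of f(x+a) is l; f <> 0). *)
Definition mult_eq (n : nat) (P : {mpoly RR[n]}) (a : 'I_n -> RR) (l : nat) : Prop :=
  mult_ge P a l /\ ~ mult_ge P a l.+1.

(* total degree (msize is 1 + total degree, 0 for the zero polynomial) *)
Definition tdeg (n : nat) (P : {mpoly RR[n]}) : nat := (msize P).-1.

Definition grid_nz (m n : nat) (c : 'I_n -> nat) : Prop :=
  (forall i, (c i <= m)%N) /\ exists i, c i <> 0%N.

Definition pt (n : nat) (c : 'I_n -> nat) : 'I_n -> RR := fun i => (c i)%:R.

Definition origin (n : nat) : 'I_n -> RR := fun _ => 0.

Definition vanishes_grid (m n k : nat) (P : {mpoly RR[n]}) : Prop :=
  forall c : 'I_n -> nat, grid_nz m c -> mult_ge P (pt c) k.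

(* Main.v *)
Require Import Defs.
From HB Require Import structures.
From mathcomp Require Import all_boot all_order all_algebra.
From mathcomp Require Import ssrcomplements mpoly.
From mathcomp Require Import Rstruct.
From mathcomp Require Import ring lra zify.
Set Implicit Arguments. Unset Strict Implicit. Unset Printing Implicit Defensive.
Import Order.TTheory GRing.Theory Num.Theory.
Local Open Scope ring_scope.

(** Let Q(x) = x(x-1)...(x-m), e = Q/x and u the power series of 1/e at 0, suitably
    truncated. For an exponent b with |b| = k-1, the residues of
    P dx / prod_i Q(x_i)^(b_i+1) over the grid sum to zero as soon as
    deg P < mn + (m+1)(k-1). A zero of order k at each nonzero grid point cancels the
    pole there, so the residue at the origin alone vanishes:
    [x^b] P prod_i u(x_i)^(b_i+1) = 0. If P has order at least k-1 at the origin this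
    reads P_b = 0 for all b, which gives (i).

    For (ii) apply this to x_j P for every j: if |b| = k-2 and
    R = P prod_i u(x_i)^(b_i+1), then [x^b] R u(x_j) = 0. As k-2 < n, some x_j does not
    divide x^b, whence [x^b] R = 0; for the other j there remains a relation between
    the coefficients of R below x^b. When k <= 4, these relations kill all coefficients
    of P of degree at most k-2, because u/u(0) has nonnegative coefficients and a
    positive linear one.

    For sharpness, every monomial of degree at least mn + (m+1)(k-1) is the leading
    monomial of a product x^t prod_i e(x_i)^(s_i) with zeros of order at least k at the
    nonzero grid points and at least k-1 at the origin. Subtracting multiples of such
    products brings the degree of x_1^l prod_i e(x_i)^k below that bound without
    changing its order at the origin. *)

(** * Univariate residues *)

Lemma coprimep_prodr (F : fieldType) (I : eqType) (r : seq I) (P : pred I)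
    (q : I -> {poly F}) (p : {poly F}) :
  {in r, forall i, P i -> coprimep p (q i)} -> coprimep p (\prod_(i <- r | P i) q i).
Proof.
move=> cop; rewrite big_seq_cond; apply: (big_ind (coprimep p)).
- exact: coprimep1.
- by move=> f g pf pg; rewrite coprimepMr pf.
- by move=> i /andP[]; apply: cop.
Qed.

Lemma dvdp_prod_coprime (F : fieldType) (I : eqType) (r : seq I)
    (q : I -> {poly F}) (p : {poly F}) :
  uniq r -> (forall i j, i != j -> coprimep (q i) (q j)) ->
  (forall i, q i %| p) -> \prod_(i <- r) q i %| p.
Proof.
move=> + cop dv; elim: r => [|i r IH] /=; first by rewrite big_nil dvd1p.
case/andP=> ir ur; rewrite big_cons Gauss_dvdp ?dv ?IH //.
rewrite coprimep_prodr // => j jr _; apply: cop.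
by apply: contraNneq ir => ->.
Qed.

Lemma modp_mul2l (F : fieldType) (p q f : {poly F}) :
  p != 0 -> q != 0 -> (p * f) %% (p * q) = p * (f %% q).
Proof.
move=> p0 q0; apply/esym/(@modpP _ _ (f %/ q)).
  by rewrite mulrCA -mulrDr -divp_eq.
have [->|r0] := eqVneq (f %% q) 0; first by rewrite mulr0 size_poly0 size_poly_gt0 mulf_neq0.
have := ltn_modpN0 f q0; rewrite !size_mul //.
by rewrite -size_poly_gt0 in p0; case: (size p) p0 => // s _; rewrite !addSn ltn_add2l.
Qed.

Lemma coefM_lead (R : nzRingType) (p r : {poly R}) (b : nat) :
  (size r <= b.+1)%N -> (p * r)`_((size p).-1 + b) = lead_coef p * r`_b.
Proof.
move=> rb; rewrite coefM lead_coefE; set s := (size p).-1.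
have sb : (s < (s + b).+1)%N by rewrite ltnS leq_addr.
rewrite (bigD1 (Ordinal sb)) //= addKn big1 ?addr0 // => j; rewrite -val_eqE /= neq_ltn.
case/orP=> [js|sj]; first by rewrite [r`__]nth_default ?mulr0 // (leq_trans rb) //; lia.
by rewrite nth_default ?mul0r // (leq_trans (leqSpred _)).
Qed.

Section Residue.
Variable F : fieldType.
Implicit Types d f p : {poly F}.

(* For monic [d], the sum of the residues of [f dX / d] at the roots of [d]. *)
Definition residue d f : F := (f %% d)`_(size d).-2.

Fact residue_is_linear d : linear_for *%R (residue d).
Proof. by move=> c f g; rewrite /residue modpD modpZl coefD coefZ. Qed.

HB.instance Definition _ d :=
  GRing.isLinear.Build F {poly F} F *%R (residue d) (residue_is_linear d).

Lemma residue_dvd d f : d %| f -> residue d f = 0.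
Proof. by move=> df; rewrite /residue modp_eq0 ?coef0. Qed.

Lemma residue_small d f : (size f < (size d).-1)%N -> residue d f = 0.
Proof.
move=> fd; rewrite /residue modp_small ?(leq_trans fd) ?leq_pred // nth_default //.
by rewrite -ltnS (leq_trans fd) ?leqSpred.
Qed.

Lemma residueXn b f : residue 'X^(b.+1) f = f`_b.
Proof.
by rewrite /residue -Pdiv.IdomainMonic.take_poly_modp size_polyXn coef_take_poly ltnSn.
Qed.

Lemma residue_mul2l p d f : p \is monic -> d != 0 -> residue (p * d) (p * f) = residue d f.
Proof.
move=> pm d0; rewrite /residue modp_mul2l // ?monic_neq0 //.
have fd := ltn_modpN0 f d0; have p0 : (0 < size p)%N by rewrite size_poly_gt0 monic_neq0.
rewrite size_monicM //; move: p0 fd; case: (size d) => [|[|s]] //.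
  by rewrite ltnS size_poly_leq0 => _ /eqP ->; rewrite mulr0 !coef0.
case: (size p) (@coefM_lead _ p (f %% d) s) => [|t] //= top _ fd.
by rewrite !addnS /= top // (monicP pm) mul1r.
Qed.

Variables (I : finType) (q : I -> {poly F}).
Hypotheses (q_monic : forall i, q i \is monic)
  (q_coprime : forall i j, i != j -> coprimep (q i) (q j)).

Lemma cofactor_inverse i : exists v, q i %| v * \prod_(j | j != i) q j - 1.
Proof.
have /Bezout_eq1_coprimepP[[c v] /= cv] : coprimep (q i) (\prod_(j | j != i) q j).
  by rewrite coprimep_prodr // => j _ ji; rewrite q_coprime // eq_sym.
by exists v; rewrite -[X in _ - X]cv opprD addrCA subrr addr0 -mulNr dvdp_mull.
Qed.

Lemma residue_partial_fractions : exists2 v : I -> {poly F},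
  (forall i, q i %| v i * \prod_(j | j != i) q j - 1) &
  (forall f, residue (\prod_i q i) f = \sum_i residue (q i) (v i * f)).
Proof.
have /fin_all_exists[v vq] := cofactor_inverse; exists v => // f.
pose N i := \prod_(j | j != i) q j.
have QN i : \prod_j q j = N i * q i by rewrite (bigD1 i) //= mulrC.
have sum_idempotents : \prod_i q i %| \sum_i v i * N i - 1.
  apply: dvdp_prod_coprime (index_enum_uniq _) q_coprime _ => i.
  rewrite (bigD1 i) //= addrAC dvdp_add ?vq //.
  apply: (big_ind (fun g => q i %| g)) => [|g h|j ji]; first exact: dvdp0.
    exact: dvdp_add.
  by rewrite dvdp_mull // /N (bigD1 i) 1?eq_sym //= dvdp_mulIl.
transitivity (residue (\prod_i q i) ((\sum_i v i * N i) * f)).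
  apply/eqP; rewrite eq_sym -subr_eq0 -raddfB -{2}[f]mul1r -mulrBl /=.
  by rewrite residue_dvd // dvdp_mulr.
rewrite mulr_suml linear_sum; apply: eq_bigr => i _ /=.
rewrite (QN i) -mulrA mulrCA residue_mul2l ?monic_neq0 //.
by apply: monic_prod => j _.
Qed.

End Residue.

Lemma local_residue_forms (F : fieldType) (I : finType) (x : I -> F) (o : I)
    (u : {poly F}) (b : nat) :
  injective x -> x o = 0 ->
  'X^(b.+1) %| u * \prod_(a | a != o) ('X - (x a)%:P) - 1 ->
  exists D : I -> {scalar {poly F}},
  [/\ forall a s, (b < s)%N -> D a (('X - (x a)%:P) ^+ s) = 0,
      forall f, D o f = (u ^+ b.+1 * f)`_b &
      forall f : {poly F}, (size f < #|I| * b.+1)%N -> \sum_a D a f = 0].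
Proof.
move=> xinj xo; set e := \prod_(a | _) _ => ue1.
pose q a : {poly F} := ('X - (x a)%:P) ^+ b.+1.
have [||v vN sum_v] := @residue_partial_fractions _ _ q.
- by move=> a; rewrite monic_exp ?monicXsubC.
- move=> a a' neq_a; apply/coprimep_expl/coprimep_expr/coprimep_XsubC2.
  by rewrite subr_eq0 (inj_eq xinj) eq_sym.
have qo : q o = 'X^(b.+1) by rewrite /q xo subr0.
have size_q : size (\prod_a q a) = (#|I| * b.+1).+1.
  rewrite prodrXl -[LHS](prednK (n := size _)) ?size_exp ?size_prod_XsubC.
    by rewrite -[index_enum I]enumT -cardE.
  by rewrite size_poly_gt0 expf_neq0 // monic_neq0 // monic_prod_XsubC.
exists (fun a => residue (q a) \o (v a \*o idfun)); split=> /=.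
- by move=> a s bs; rewrite residue_dvd // dvdp_mull // dvdp_exp2l.
- move=> f; rewrite qo residueXn; apply/eqP; rewrite -subr_eq0 -coefB -mulrBl -residueXn.
  have {}ue1 : 'X^(b.+1) %| (u * e) ^+ b.+1 - 1 by rewrite subrX1 dvdp_mulr.
  have {}vN : 'X^(b.+1) %| v o * e ^+ b.+1 - 1 by rewrite -qo -prodrXl vN.
  rewrite residue_dvd // dvdp_mulr //.
  have -> : v o - u ^+ b.+1 = u ^+ b.+1 * (v o * e ^+ b.+1 - 1) - v o * ((u * e) ^+ b.+1 - 1).
    by rewrite exprMn; ring.
  by rewrite dvdp_sub // dvdp_mull.
by move=> f fI; rewrite -sum_v residue_small // size_q.
Qed.

(** * Truncated inverses of products of linear factors *)

Lemma coef0_exp (R : nzRingType) (p : {poly R}) r : (p ^+ r)`_0 = p`_0 ^+ r.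
Proof. by elim: r => [|r IH]; rewrite ?coef1 // !exprS coef0M IH. Qed.

Lemma coef1M (R : nzRingType) (p q : {poly R}) : (p * q)`_1 = p`_0 * q`_1 + p`_1 * q`_0.
Proof. by rewrite coefM !big_ord_recl big_ord0 addr0. Qed.

Lemma coef1_exp (R : comNzRingType) (p : {poly R}) r : p`_0 = 1 -> (p ^+ r)`_1 = p`_1 *+ r.
Proof.
move=> p0; elim: r => [|r IH]; first by rewrite coef1.
by rewrite exprS coef1M IH p0 coef0_exp p0 expr1n mul1r mulr1 mulrSr.
Qed.

Section TruncatedInverse.
Variables (I : finType) (A : pred I) (K : nat).

(* Agrees modulo ['X^K] with the power series of [\prod_i (1 - 'X / y i)^-1]. *)
Definition truncated_inverse (F : fieldType) (y : I -> F) : {poly F} :=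
  \prod_(i | A i) \poly_(s < K) (y i)^-1 ^+ s.

Lemma truncated_inverseP (F : fieldType) (y : I -> F) : (forall i, A i -> y i != 0) ->
  'X^K %| (\prod_(i | A i) (- y i)^-1) *: truncated_inverse y *
          \prod_(i | A i) ('X - (y i)%:P) - 1.
Proof.
move=> y0; rewrite -scaler_prod -big_split /=.
apply: (big_ind (fun p => 'X^K %| p - 1)) => [|p r p1 r1|i /y0 yi]; first by rewrite subrr dvdp0.
  have -> : p * r - 1 = (p - 1) * r + (r - 1) by ring.
  by rewrite dvdp_add // dvdp_mulr.
have -> : (- y i)^-1 *: \poly_(s < K) (y i)^-1 ^+ s * ('X - (y i)%:P) = 1 - ((y i)^-1 *: 'X) ^+ K.
  rewrite -(opprB _ 1) subrX1 poly_def -scalerAl mulrC scalerAl -mulNr; congr (_ * _).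
    by rewrite scalerBr !invrN !scaleNr -!mul_polyC -polyCM mulVf // opprD.
  by apply: eq_bigr => s _; rewrite exprZn.
by rewrite addrC addKr dvdpNr exprZn -mul_polyC dvdp_mull.
Qed.

Lemma truncated_inverse_coef0 (F : fieldType) (y : I -> F) :
  (0 < K)%N -> (truncated_inverse y)`_0 = 1.
Proof. by move=> K0; rewrite coef0_prod big1 // => i _; rewrite coef_poly K0. Qed.

End TruncatedInverse.

Lemma truncated_inverse_coef_ge0 (I : finType) (A : pred I) K (F : realFieldType) (y : I -> F) :
  (forall i, A i -> 0 < y i) -> forall s, 0 <= (truncated_inverse A K y)`_s.
Proof.
move=> y0; pose nonneg_coef (p : {poly F}) := forall s, 0 <= p`_s.
apply: (big_ind nonneg_coef) => [s|p r p0 r0 s|i /y0 yi s].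
- by rewrite coef1 ler0n.
- by rewrite coefM sumr_ge0 // => j _; rewrite mulr_ge0.
- by rewrite coef_poly; case: ifP => // _; rewrite exprn_ge0 // invr_ge0 ltW.
Qed.

Lemma truncated_inverse_coef1_gt0 (I : finType) (A : pred I) K (F : realFieldType) (y : I -> F) :
  (1 < K)%N -> (forall i, A i -> 0 < y i) -> (exists i, A i) ->
  0 < (truncated_inverse A K y)`_1.
Proof.
move=> K1 y0 [i Ai]; rewrite /truncated_inverse (bigD1 i) //= coef1M !coef_poly K1 ltnW //.
rewrite mul1r coef0_prod [X in _ * X]big1 ?mulr1 => [|j _]; last by rewrite coef_poly ltnW.
rewrite ltr_wpDl ?invr_gt0 ?y0 //.
by apply: truncated_inverse_coef_ge0 => j /andP[/y0].
Qed.

(** * Residues on a grid *)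

Local Notation in_var i := (horner_alg ('X_i : {mpoly _[_]})).

Section TensorForm.
Variables (R : comNzRingType) (n : nat).
Implicit Types (P : {mpoly R[n]}) (g b : 'X_{1..n}).

Definition tensor_form (t : 'I_n -> {poly R} -> R) P : R :=
  \sum_(g <- msupp P) P@_g * \prod_i t i 'X^(g i).

Lemma tensor_formE t P d : (msize P <= d)%N ->
  tensor_form t P = \sum_(g : 'X_{1..n < d}) P@_g * \prod_i t i 'X^(g i).
Proof.
move=> Pd; rewrite /tensor_form (big_mksub ('X_{1..n < d})) ?msupp_uniq //=; last first.
  by move=> g /msize_mdeg_lt /leq_trans; apply.
by rewrite big_rmcond //= => g /memN_msupp_eq0 ->; rewrite mul0r.
Qed.

Fact tensor_form_is_linear t : linear_for *%R (tensor_form t).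
Proof.
move=> c P Q; pose d := maxn (msize (c *: P + Q)) (maxn (msize P) (msize Q)).
rewrite !(@tensor_formE _ _ d) ?leq_max ?leqnn ?orbT //.
rewrite mulr_sumr -big_split /=; apply: eq_bigr => g _.
by rewrite mcoeffD mcoeffZ mulrDl mulrA.
Qed.

HB.instance Definition _ t :=
  GRing.isLinear.Build R {mpoly R[n]} R *%R (tensor_form t) (tensor_form_is_linear t).

Lemma tensor_formX t g : tensor_form t 'X_[g] = \prod_i t i 'X^(g i).
Proof. by rewrite /tensor_form msuppX big_seq1 mcoeffX eqxx mul1r. Qed.

Lemma tensor_form_sum (I : finType) (D : 'I_n -> I -> {poly R} -> R) P :
  tensor_form (fun i f => \sum_a D i a f) P =
  \sum_(h : {ffun 'I_n -> I}) tensor_form (fun i => D i (h i)) P.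
Proof.
rewrite /tensor_form exchange_big; apply: eq_bigr => g _ /=.
by rewrite -mulr_sumr bigA_distr_bigA.
Qed.

Lemma tensor_form_prod (t : 'I_n -> {scalar {poly R}}) (f : 'I_n -> {poly R}) :
  tensor_form t (\prod_i in_var i (f i)) = \prod_i t i (f i).
Proof.
pose d := \max_i size (f i).
have fE i : f i = \sum_(s < d) (f i)`_s *: 'X^s.
  by rewrite -poly_def -[RHS]/(take_poly d (f i)) take_poly_id // leq_bigmax.
under eq_bigr => i _ do rewrite [f i]fE linear_sum.
under [RHS]eq_bigr => i _ do rewrite [f i]fE linear_sum.
rewrite !bigA_distr_bigA linear_sum; apply: eq_bigr => h _ /=.
under eq_bigr => i _ do rewrite linearZ rmorphXn /= horner_algX mulr_algl.
under [RHS]eq_bigr => i _ do rewrite linearZ /=.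
pose g : 'X_{1..n} := [multinom (h i : nat) | i < n].
rewrite scaler_prod [X in _ *: X](_ : _ = 'X_[g]) ?linearZ /= ?tensor_formX ?big_split /=.
  by congr (_ * _); apply: eq_bigr => i _; rewrite mnmE.
by rewrite [RHS]mpolyXE_id; apply: eq_bigr => i _; rewrite mnmE.
Qed.

Lemma tensor_form_coef b P : tensor_form (fun i => coefp (b i)) P = P@_b.
Proof.
rewrite [in RHS](mpolyE P) linear_sum; apply: eq_bigr => g _ /=.
rewrite mcoeffZ mcoeffX; congr (_ * _).
under eq_bigr => i _ do rewrite coefXn.
have [->|gb] := eqVneq g b; first by rewrite big1 // => i _; rewrite eqxx.
have [i gbi] : exists i, b i != g i.
  apply/existsP; apply: contraR gb; rewrite negb_exists => /forallP gb.
  by apply/eqP/mnmP => i; apply/eqP; rewrite eq_sym -[_ == _]negbK.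
by rewrite (bigD1 i) //= (negPf gbi) mul0r.
Qed.

Lemma mcoeffM_prod_in_var (f : 'I_n -> {poly R}) P b :
  (P * \prod_i in_var i (f i))@_b = tensor_form (fun i p => (f i * p)`_(b i)) P.
Proof.
rewrite {1}(mpolyE P) mulr_suml linear_sum; apply: eq_bigr => g _ /=.
rewrite -scalerAl mcoeffZ mpolyXE_id -big_split /=; congr (_ * _).
under eq_bigr => i _ do rewrite -[X in X ^+ _]horner_algX -rmorphXn -rmorphM mulrC.
by rewrite -tensor_form_coef (tensor_form_prod (fun i => coefp (b i))).
Qed.

(* [shift_mpoly] is the instance of [translate] at the reals. *)
Definition translate P (a : 'I_n -> R) : {mpoly R[n]} :=
  P \mPo [tuple 'X_i + (a i)%:MP | i < n].

Lemma translateK P a : translate (translate P a) (\- a) = P.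
Proof.
rewrite [in RHS](mpolyE P) /translate (comp_mpolyEX P) linear_sum; apply: eq_bigr => g _ /=.
rewrite linearZ /= comp_mpolyX rmorph_prod mpolyXE_id; congr (_ *: _).
apply: eq_bigr => i _; rewrite rmorphXn /= tnth_mktuple rmorphD /=.
by rewrite comp_mpolyXU comp_mpolyC -tnth_nth tnth_mktuple mpolyCN subrK.
Qed.

Lemma tensor_form_translate (t : 'I_n -> {scalar {poly R}}) P a :
  tensor_form t P = \sum_(g <- msupp (translate P a))
    (translate P a)@_g * \prod_i t i (('X - (a i)%:P) ^+ g i).
Proof.
rewrite -{1}(translateK P a) /translate comp_mpolyE linear_sum; apply: eq_bigr => g _.
rewrite linearZ /= -tensor_form_prod; congr (_ * tensor_form t _).
apply: eq_bigr => i _; rewrite tnth_mktuple rmorphXn rmorphB /= horner_algX horner_algC.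
by rewrite mpolyCN alg_mpolyC.
Qed.

End TensorForm.

Lemma mdeg_lt_exists (n : nat) (b g : 'X_{1..n}) :
  (mdeg b < mdeg g)%N -> exists i, (b i < g i)%N.
Proof.
move=> bg; apply/existsP; apply: contraLR bg; rewrite negb_exists => /forallP gb.
by rewrite -leqNgt !mdegE; apply: leq_sum => i _; rewrite leqNgt.
Qed.

(* The poles away from the origin are cancelled by the zeros of [P], so the residue at
   the origin is the only term of the residue theorem. *)
Theorem grid_residue (F : fieldType) (I : finType) (x : I -> F) (o : I) (n : nat)
    (b : 'X_{1..n}) (u : {poly F}) (P : {mpoly F[n]}) :
  injective x -> x o = 0 ->
  (forall i, 'X^((b i).+1) %| u * \prod_(a | a != o) ('X - (x a)%:P) - 1) ->
  (forall h : {ffun 'I_n -> I}, h != [ffun=> o] ->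
     {in msupp (translate P (x \o h)), forall g, (mdeg b < mdeg g)%N}) ->
  (msize P + n <= #|I| * (mdeg b + n))%N ->
  (P * \prod_i in_var i (u ^+ (b i).+1))@_b = 0.
Proof.
move=> xinj xo ue1 zeros degP.
have /fin_all_exists[D Dspec] := fun i => local_residue_forms xinj xo (ue1 i).
have Dzero i := let: And3 zero _ _ := Dspec i in zero.
have Dorigin i := let: And3 _ origin _ := Dspec i in origin.
have Dsum i := let: And3 _ _ sum := Dspec i in sum.
have : tensor_form (fun i f => \sum_a D i a f) P = 0.
  rewrite /tensor_form big_seq big1 // => g gP.
  suff [i gi] : exists i, ((g i).+1 < #|I| * (b i).+1)%N.
    by rewrite (bigD1 i) //= Dsum ?size_polyXn // mul0r mulr0.
  apply/existsP; apply: contraLR (msize_mdeg_lt gP); rewrite negb_exists => /forallP big_g.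
  rewrite -leqNgt -(leq_add2r n) (leq_trans degP) // !mdegE.
  have nE : n = (\sum_(i < n) 1)%N by rewrite sum1_card card_ord.
  rewrite [X in (_ * (_ + X))%N]nE [X in (_ <= _ + X)%N]nE -!big_split big_distrr.
  apply: leq_sum => i _ /=.
  by rewrite !addn1 leqNgt.
rewrite tensor_form_sum (bigD1 [ffun=> o]) //= big1 ?addr0 => [<-|h ho].
  rewrite mcoeffM_prod_in_var; apply: eq_bigr => g _; congr (_ * _).
  by apply: eq_bigr => i _; rewrite ffunE Dorigin.
rewrite (tensor_form_translate _ _ (x \o h)) big_seq big1 // => g /(zeros h ho).
case/mdeg_lt_exists=> i /Dzero Di.
by rewrite (bigD1 i) //= Di mul0r mulr0.
Qed.

(** * Low-degree coefficients *)

Lemma submm n (g : 'X_{1..n}) : (g - g = 0)%MM.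
Proof. by rewrite -[X in (X - _)%MM]add0m addmK. Qed.

Section ProductCoefficients.
Variables (R : comNzRingType) (n : nat).
Implicit Types (P Q : {mpoly R[n]}) (b g : 'X_{1..n}) (w : {poly R}).

Lemma mcoeffMX_sub P g b : (P * 'X_[g])@_b = if (g <= b)%MM then P@_(b - g) else 0.
Proof.
case: ifPn => [gb|]; first by rewrite -[in LHS](submK gb) addmC mcoeffMX.
apply: contraNeq; rewrite -mcoeff_msupp (perm_mem (msuppMX _ _)).
by case/mapP=> h _ ->; apply: lem_addr.
Qed.

Lemma mcoeffM_low P Q b :
  (forall g, (mdeg g < mdeg b)%N -> P@_g = 0) -> (P * Q)@_b = P@_b * Q@_0.
Proof.
move=> low; rewrite {1}(mpolyE Q) mulr_sumr [in RHS](mpolyE Q) !linear_sum mulr_sumr.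
apply: eq_bigr => g _ /=; rewrite -scalerAr !mcoeffZ mulrCA; congr (_ * _).
rewrite mcoeffMX_sub mcoeffX; have [->|g0] := eqVneq g 0%MM.
  by rewrite subm0 mulr1 ifT //; apply/mnm_lepP => i; rewrite mnm0E.
rewrite mulr0; case: ifP => // gb; apply: low.
by rewrite -{2}(submK gb) mdegD -addn1 leq_add2l lt0n mdeg_eq0.
Qed.

Lemma mcoeffM_in_var j (f : {poly R}) P b :
  (P * in_var j f)@_b = \sum_(s < (b j).+1) f`_s * P@_(b - U_(j) *+ s).
Proof.
pose d := maxn (size f) (b j).+1.
rewrite (_ : in_var j f = \sum_(s < d) f`_s *: 'X_[U_(j) *+ s]); last first.
  rewrite -{1}(take_poly_id (leq_maxl _ _ : (size f <= d)%N)) /take_poly poly_def linear_sum.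
  apply: eq_bigr => s _ /=.
  by rewrite linearZ rmorphXn /= horner_algX mulr_algl mpolyXn.
rewrite mulr_sumr linear_sum (big_ord_widen d (fun s => f`_s * P@_(b - U_(j) *+ s))) ?leq_maxr //.
rewrite [RHS]big_mkcond; apply: eq_bigr => s _ /=.
rewrite -scalerAr mcoeffZ mcoeffMX_sub ltnS (_ : (_ <= _)%MM = (s <= b j)%N).
  by case: leqP; rewrite ?mulr0.
apply/mnm_lepP/idP => [/(_ j)|sb i]; rewrite mulmnE mnm1E ?eqxx ?mul1n //.
by case: eqP => [<-|]; rewrite ?mul1n.
Qed.

Lemma mcoeffM_prod_in_var_free (A : pred 'I_n) (f : 'I_n -> {poly R}) P b :
  (forall i, A i -> b i = 0) ->
  (P * \prod_(i | A i) in_var i (f i))@_b = P@_b * \prod_(i | A i) (f i)`_0.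
Proof.
move=> b0; elim/big_rec2: _ => [|i y1 y2 /b0 bi IH]; first by rewrite !mulr1.
by rewrite mulrCA mulrC mcoeffM_in_var bi big_ord1 mulm0n subm0 IH mulrCA.
Qed.

Definition pole_weight w b : {mpoly R[n]} :=
  \prod_i in_var i (w ^+ (b i).+1).

Lemma pole_weightZ (c : R) w b :
  pole_weight (c *: w) b = (\prod_i c ^+ (b i).+1) *: pole_weight w b.
Proof.
by rewrite -scaler_prod; apply: eq_bigr => i _; rewrite exprZn linearZ /= mulr_algl.
Qed.

Lemma pole_weightDU w b j : pole_weight w (b + U_(j)) = pole_weight w b * in_var j w.
Proof.
rewrite /pole_weight !(bigD1 j (P := xpredT)) //= mnmDE mnm1E eqxx addn1 exprSr rmorphM /=.
rewrite mulrAC; congr (_ * _ * _); apply: eq_bigr => i ij.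
by rewrite mnmDE mnm1E eq_sym (negPf ij) addn0.
Qed.

Lemma pole_weight_coef0 w b : w`_0 = 1 -> (pole_weight w b)@_0 = 1.
Proof.
move=> w0; rewrite -[pole_weight _ _]mul1r mcoeffM_prod_in_var_free => [|i _]; last exact: mnm0E.
by rewrite mcoeff1 eqxx mul1r big1 // => i _; rewrite coef0_exp w0 expr1n.
Qed.

Lemma mcoeffM_pole_weightU w b P j : w`_0 = 1 ->
  (P * pole_weight w b)@_U_(j) = P@_U_(j) + (b j).+1%:R * w`_1 * P@_0.
Proof.
move=> w0; rewrite /pole_weight (bigD1 j) //= mulrA mcoeffM_prod_in_var_free; last first.
  by move=> i ij; rewrite mnm1E eq_sym (negPf ij).
have wX0 r : (w ^+ r)`_0 = 1 by rewrite coef0_exp w0 expr1n.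
rewrite [X in _ * X]big1 ?mulr1 // mcoeffM_in_var mnm1E eqxx !big_ord_recl big_ord0 /=.
rewrite mulm0n subm0 mulm1n submm wX0 mul1r addr0.
by rewrite coef1_exp // mulr_natl.
Qed.

End ProductCoefficients.

Section LowCoefficients.
Variables (F : realFieldType) (n : nat) (w : {poly F}) (P : {mpoly F[n]}).
Implicit Types b g : 'X_{1..n}.
Hypothesis w0 : w`_0 = 1.

Definition pole_relations b := forall j, (P * pole_weight w (b + U_(j)))@_b = 0.

Lemma mcoeffM_pole_weight_eq0 b : (mdeg b < n)%N ->
  pole_relations b -> (P * pole_weight w b)@_b = 0.
Proof.
move=> bn; have [|j bj] := @mdeg_lt_exists n b [multinom 1%N | _ < n].
  rewrite [X in (_ < X)%N]mdegE; under eq_bigr => i _ do rewrite mnmE.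
  by rewrite sum1_card card_ord.
move/(_ j); rewrite pole_weightDU mulrA mcoeffM_in_var.
by move: bj; rewrite mnmE ltnS leqn0 => /eqP ->; rewrite big_ord1 mulm0n subm0 w0 mul1r.
Qed.

Lemma mcoeffM_pole_weight_tail b : (mdeg b < n)%N -> pole_relations b ->
  forall j, \sum_(s < b j) w`_s.+1 * (P * pole_weight w b)@_(b - U_(j) *+ s.+1) = 0.
Proof.
move=> bn rel j; have := rel j; rewrite pole_weightDU mulrA mcoeffM_in_var big_ord_recl.
by rewrite mulm0n subm0 mcoeffM_pole_weight_eq0 // mulr0 add0r.
Qed.

Hypotheses (w1 : 0 < w`_1) (w2 : 0 <= w`_2).

Lemma const_coef_eq0 (j : 'I_n) : (1 < n)%N ->
  (forall b, mdeg b = 1 -> pole_relations b) -> P@_0 = 0.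
Proof.
move=> n1 rel; have deg_lt : (mdeg U_(j) < n)%N by rewrite mdeg1.
have := mcoeffM_pole_weight_tail deg_lt (rel _ (mdeg1 j)) j.
rewrite mnm1E eqxx big_ord1 mulm1n submm mcoeffM_low ?mdeg0 // pole_weight_coef0 // mulr1.
by move/eqP; rewrite mulf_eq0 gt_eqF //= => /eqP.
Qed.

Lemma affine_coef_eq0 (i j : 'I_n) : i != j -> (2 < n)%N ->
  (forall b, mdeg b = 2 -> pole_relations b) ->
  P@_0 = 0 /\ P@_U_(j) = 0.
Proof.
move=> ij n2 rel.
have mixed : w`_1 * (P@_U_(j) + 2 * w`_1 * P@_0) = 0.
  have deg2 : mdeg (U_(j) + U_(i)) = 2%N by rewrite mdegD !mdeg1.
  have deg_lt : (mdeg (U_(j) + U_(i)) < n)%N by rewrite deg2.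
  have := mcoeffM_pole_weight_tail deg_lt (rel _ deg2) i.
  rewrite mnmDE !mnm1E eqxx [j == i]eq_sym (negPf ij) big_ord1 mulm1n addmK.
  by rewrite mcoeffM_pole_weightU // mnmDE !mnm1E eqxx (negPf ij).
have square : w`_1 * (P@_U_(j) + 3 * w`_1 * P@_0) + w`_2 * P@_0 = 0.
  have deg2 : mdeg (U_(j) *+ 2) = 2%N by rewrite mdegMn mdeg1.
  have deg_lt : (mdeg (U_(j) *+ 2) < n)%N by rewrite deg2.
  have := mcoeffM_pole_weight_tail deg_lt (rel _ deg2) j.
  rewrite mulmnE mnm1E eqxx !big_ord_recl big_ord0 addr0 /= mulm1n.
  rewrite [X in w`_1 * _@_X](_ : _ = U_(j)%MM); last by rewrite mulmS mulm1n addmK.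
  rewrite [X in w`_2 * _@_X](_ : _ = 0%MM); last exact: submm.
  rewrite mcoeffM_pole_weightU // mulmnE mnm1E eqxx mcoeffM_low ?pole_weight_coef0 ?mulr1 //.
  by rewrite mdeg0.
have P0 : P@_0 = 0.
  have /mulfI : w`_1 ^+ 2 + w`_2 != 0 by rewrite gt_eqF // ltr_wpDr ?exprn_gt0.
  by apply; lra.
by split=> //; apply: (mulfI (lt0r_neq0 w1)); move: mixed; rewrite P0 mulr0 addr0 mulr0.
Qed.

Lemma low_coef_eq0 d : (d <= 2)%N -> (d < n)%N ->
  (forall b, mdeg b = d -> pole_relations b) ->
  forall g, (mdeg g <= d)%N -> P@_g = 0.
Proof.
move=> d2 dn rel.
have top : (forall g, (mdeg g < d)%N -> P@_g = 0) -> forall g, (mdeg g <= d)%N -> P@_g = 0.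
  move=> low g; rewrite leq_eqVlt => /orP[/eqP gd|]; last exact: low.
  have deg_lt : (mdeg g < n)%N by rewrite gd.
  have := mcoeffM_pole_weight_eq0 deg_lt (rel g gd).
  by rewrite mcoeffM_low ?gd // pole_weight_coef0 // mulr1.
apply: top => g; case: d d2 dn rel => [|[|[|//]]] _ dn rel //.
  by rewrite ltnS leqn0 mdeg_eq0 => /eqP ->; apply: const_coef_eq0 (Ordinal dn) dn rel.
rewrite ltnS leq_eqVlt ltnS leqn0 mdeg_eq0 => g1.
have affine j : P@_0 = 0 /\ P@_U_(j) = 0.
  have /card_gt0P[i ij] : (0 < #|predC1 j|)%N.
    by rewrite cardC1 card_ord -subn1 subn_gt0 (ltnW dn).
  exact: affine_coef_eq0 ij dn rel.
case/orP: g1 => [/mdeg1P[j /eqP ->]|/eqP ->]; first exact: (affine j).2.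
exact: (affine (Ordinal dn)).1.
Qed.

End LowCoefficients.

(** * Multiplicities *)

Lemma shift_mpoly_origin (n : nat) (P : {mpoly RR[n]}) : shift_mpoly P (@origin n) = P.
Proof.
rewrite -[RHS]comp_mpoly_id /shift_mpoly; congr (P \mPo _).
by apply: eq_from_tnth => i; rewrite !tnth_mktuple mpolyC0 addr0.
Qed.

Lemma mult_ge_originP (n : nat) (P : {mpoly RR[n]}) (k : nat) :
  mult_ge P (@origin n) k <-> forall g, (mdeg g < k)%N -> P@_g = 0.
Proof.
rewrite /mult_ge shift_mpoly_origin; split=> [ord g gk|low g].
  by apply: memN_msupp_eq0; apply: contraL gk => /ord; rewrite leqNgt.
by rewrite mcoeff_msupp; apply: contraR; rewrite -ltnNge => /low ->.
Qed.

Lemma mult_ge_poly0 (n : nat) (a : 'I_n -> RR) (k : nat) : mult_ge (0 : {mpoly RR[n]}) a k.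
Proof. by move=> g; rewrite /shift_mpoly rmorph0 msupp0. Qed.

Lemma mult_ge_leq (n : nat) (P : {mpoly RR[n]}) (a : 'I_n -> RR) (k l : nat) :
  (k <= l)%N -> mult_ge P a l -> mult_ge P a k.
Proof. by move=> kl ordP g /ordP; apply: leq_trans. Qed.

Lemma mult_ge_lin (n : nat) (c : RR) (P Q : {mpoly RR[n]}) (a : 'I_n -> RR) (k : nat) :
  mult_ge P a k -> mult_ge Q a k -> mult_ge (c *: P + Q) a k.
Proof.
move=> ordP ordQ g; rewrite /shift_mpoly rmorphD /= comp_mpolyZ => /msuppD_le.
by rewrite mem_cat => /orP[/msuppZ_le/ordP|/ordQ].
Qed.

Lemma mult_geM (n : nat) (P Q : {mpoly RR[n]}) (a : 'I_n -> RR) (k l : nat) :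
  mult_ge P a k -> mult_ge Q a l -> mult_ge (P * Q) a (k + l).
Proof.
move=> ordP ordQ g; rewrite /shift_mpoly rmorphM => /msuppM_le/allpairsP[[h h'] /= []].
by move=> /ordP kh /ordQ lh' ->; rewrite mdegD leq_add.
Qed.

Lemma mult_geMr (n : nat) (P Q : {mpoly RR[n]}) (a : 'I_n -> RR) (k : nat) :
  mult_ge P a k -> mult_ge (P * Q) a k.
Proof. by move=> ordP; rewrite -[k]addn0; apply: mult_geM. Qed.

Lemma mult_geX (n : nat) (P : {mpoly RR[n]}) (a : 'I_n -> RR) (k r : nat) :
  mult_ge P a k -> mult_ge (P ^+ r) a (r * k).
Proof.
by move=> ordP; elim: r => [//|r IH]; rewrite exprS mulSn; apply: mult_geM.
Qed.

Lemma mult_ge_prod (n : nat) (I : finType) (f : I -> {mpoly RR[n]}) (a : 'I_n -> RR)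
    (k : I -> nat) :
  (forall i, mult_ge (f i) a (k i)) -> mult_ge (\prod_i f i) a (\sum_i k i).
Proof.
by move=> ordf; elim/big_rec2: _ => [//|i l p _ IH]; apply: mult_geM.
Qed.

Lemma mult_ge_XsubC (n : nat) (i : 'I_n) (a : 'I_n -> RR) (c : RR) :
  a i = c -> mult_ge ('X_i - c%:MP) a 1.
Proof.
move=> <- g; rewrite /shift_mpoly rmorphB /= comp_mpolyXU comp_mpolyC -tnth_nth.
by rewrite tnth_mktuple addrK msuppX inE => /eqP ->; rewrite mdeg1.
Qed.

(** * Lower bounds *)

Definition node_inverse (m K : nat) : {poly RR} :=
  truncated_inverse (predC1 (ord0 : 'I_m.+1)) K (fun a => a%:R).

Lemma vanishes_grid_coef_eq0 (m n k : nat) (P : {mpoly RR[n]}) (b : 'X_{1..n}) :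
  vanishes_grid m k P -> (mdeg b < k)%N -> (msize P <= m * n + m.+1 * mdeg b)%N ->
  (P * pole_weight (node_inverse m k) b)@_b = 0.
Proof.
move=> van bk degP; pose x (a : 'I_m.+1) : RR := a%:R.
have x_neq0 a : predC1 ord0 a -> x a != 0 by rewrite /= -lt0n pnatr_eq0 -lt0n.
pose c : RR := \prod_(a | predC1 ord0 a) (- x a)^-1.
have c0 : c != 0 by apply/prodf_neq0 => a a0; rewrite invr_neq0 // oppr_eq0 x_neq0.
have cb0 : \prod_i c ^+ (b i).+1 != 0 by apply/prodf_neq0 => i _; rewrite expf_neq0.
apply: (mulfI cb0); rewrite mulr0 -mcoeffZ scalerAr -pole_weightZ.
apply: (@grid_residue _ _ x ord0) => //.
- by move=> i j /eqP; rewrite eqr_nat => /eqP/val_inj.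
- move=> i; apply: dvdp_trans (truncated_inverseP k x_neq0); rewrite dvdp_exp2l //.
  by apply: leq_ltn_trans bk; rewrite mdegE (bigD1 i) //= leq_addr.
- move=> h h0 g gP; apply: leq_trans bk _; apply: (van (fun i => h i)) gP.
  split=> [i|]; first by rewrite -ltnS.
  have /existsP[i hi] : [exists i, h i != ord0].
    by apply: contraR h0 => /existsPn h0; apply/eqP/ffunP => i; rewrite ffunE; apply/eqP/negPn.
  by exists i; apply/eqP.
by rewrite card_ord mulnDr (mulSnr m n) addnA leq_add2r addnC.
Qed.

Lemma tdeg_ge_order_pred (m n k : nat) (P : {mpoly RR[n]}) : (0 < k)%N ->
  vanishes_grid m k P -> mult_eq P (@origin n) (k - 1) ->
  (m * n + m.+1 * (k - 1) <= tdeg P)%N.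
Proof.
move=> k0 van [/mult_ge_originP low exact_order]; rewrite leqNgt; apply/negP => degP.
have k1 : (k - 1 < k)%N by rewrite ltn_subrL.
apply: exact_order; apply/mult_ge_originP => g; rewrite ltnS leq_eqVlt => /orP[/eqP gk|/low //].
have := @vanishes_grid_coef_eq0 m n k P g van; rewrite gk => /(_ k1).
rewrite mcoeffM_low ?gk // pole_weight_coef0 ?truncated_inverse_coef0 // mulr1; apply.
by rewrite (leq_trans (leqSpred _)).
Qed.

Lemma tdeg_ge_low_order (m n k l : nat) (P : {mpoly RR[n]}) : (0 < m)%N -> (1 < k <= 4)%N ->
  vanishes_grid m k P -> mult_eq P (@origin n) l -> (l <= k - 2)%N -> (k - 1 <= n)%N ->
  (m * n + m.+1 * (k - 1) - 1 <= tdeg P)%N.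
Proof.
move=> m0 /andP[k1 k4] van [_ exact_order] lk kn.
rewrite leqNgt ltn_subRL add1n; apply/negP => degP.
have posx (a : 'I_m.+1) : predC1 ord0 a -> 0 < a%:R :> RR by rewrite /= ltr0n -lt0n.
apply: exact_order; apply/mult_ge_originP => g gl.
apply: (@low_coef_eq0 _ n (node_inverse m k) P _ _ _ (k - 2)).
- exact: truncated_inverse_coef0 (ltnW k1).
- apply: truncated_inverse_coef1_gt0 k1 posx _.
  by exists ord_max; rewrite /= -val_eqE /= -lt0n.
- exact: truncated_inverse_coef_ge0 posx _.
- by rewrite leq_subLR.
- by apply: leq_trans kn; rewrite ltn_sub2l.
- move=> b bk j; have [->|P0] := eqVneq P 0; first by rewrite mul0r mcoeff0.
  have bk1 : mdeg (b + U_(j)) = (k - 1)%N by rewrite mdegD mdeg1 bk addn1 -subSn.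
  rewrite -(mcoeffMX _ U_(j)) addmC mulrAC; apply: vanishes_grid_coef_eq0; rewrite ?bk1.
  + by move=> c /van ord; apply: mult_geMr.
  + by rewrite ltn_subrL (ltnW k1).
  rewrite msizeM // -?msize_poly_eq0 msizeX // mdeg1 addn2 (leq_trans _ degP) //.
  by rewrite ltnS leqSpred.
by apply: leq_trans lk.
Qed.

(** * Extremal polynomials *)

Lemma mlead_reduction (F : fieldType) (n D : nat) (V : {mpoly F[n]} -> Prop) :
  V 0 -> (forall c P Q, V P -> V Q -> V (c *: P + Q)) ->
  (forall g, (D <= mdeg g)%N -> exists G, [/\ V G, G != 0 & mlead G = g]) ->
  forall P, exists2 Q, V Q & (msize (P + Q) <= D)%N.
Proof.
move=> V0 VL leads P; elim/mleadrect: P => P IH.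
have [small|big] := leqP (msize P) D; first by exists 0; rewrite ?addr0.
have P0 : P != 0 by apply: contraTneq big => ->; rewrite msize0.
have [|G [VG G0 leadG]] := leads (mlead P); first by rewrite -ltnS mlead_deg.
have GP : G@_(mlead P) != 0 by rewrite -leadG mleadc_eq0.
pose c := - (mleadc P / G@_(mlead P)); pose R := P + c *: G.
have R_lead : R@_(mlead P) = 0 by rewrite mcoeffD mcoeffZ mulNr divfK ?subrr.
have [R0|R0] := eqVneq R 0.
  by exists (c *: G + 0); [exact: VL | rewrite addr0 -/R R0 msize0].
have [|Q VQ sQ] := IH R.
  rewrite lt_neqAle; apply/andP; split.
    by apply: contraNneq R0 => leadR; rewrite -mleadc_eq0 leadR R_lead.
  apply: le_trans (mleadD_le _ _) _; rewrite leUx lexx /=.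
  by apply: le_trans (mleadZ_le _ _) _; rewrite leadG.
by exists (c *: G + Q); [exact: VL | rewrite addrA].
Qed.

Lemma mlead_XsubC (R : idomainType) n (i : 'I_n) (c : R) : mlead ('X_i - c%:MP) = U_(i)%MM.
Proof.
rewrite mleadDl ?mleadXm // mleadN mleadC.
by apply: lt_mdeg_ltmc; rewrite mdeg0 mdeg1.
Qed.

Lemma XsubC_neq0 (R : idomainType) n (i : 'I_n) (c : R) : 'X_i - c%:MP != 0 :> {mpoly R[n]}.
Proof.
by apply: contra_eq_neq (mlead_XsubC i c) => ->; rewrite mlead0 eq_sym mnm1_eq0.
Qed.

Section NodeProduct.
Variables (R : numDomainType) (m n : nat).

Definition node_factor (i : 'I_n) : {mpoly R[n]} :=
  \prod_(j < m) ('X_i - (j.+1%:R)%:MP).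

Definition node_product (s t : 'X_{1..n}) : {mpoly R[n]} :=
  'X_[t] * \prod_i node_factor i ^+ s i.

Lemma node_factor_neq0 (i : 'I_n) : node_factor i != 0.
Proof. by apply/prodf_neq0 => j _; apply: XsubC_neq0. Qed.

Lemma node_product_neq0 (s t : 'X_{1..n}) : node_product s t != 0.
Proof.
rewrite mulf_neq0 -?msize_poly_eq0 ?msizeX // msize_poly_eq0.
by apply/prodf_neq0 => i _; rewrite expf_neq0 // node_factor_neq0.
Qed.

Lemma mlead_node_factor (i : 'I_n) : mlead (node_factor i) = (U_(i) *+ m)%MM.
Proof.
rewrite mlead_prod => [|j _ _]; last exact: XsubC_neq0.
under eq_bigr => j _ do rewrite mlead_XsubC.
by apply/mnmP => l; rewrite mnm_sumE sum_nat_const card_ord mulmnE mulnC.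
Qed.

Lemma mlead_node_product (s t : 'X_{1..n}) :
  mlead (node_product s t) = (s *+ m + t)%MM.
Proof.
have factor_neq0 i : node_factor i ^+ s i != 0 by rewrite expf_neq0 // node_factor_neq0.
rewrite mleadM -?msize_poly_eq0 ?msizeX // ?msize_poly_eq0; last by apply/prodf_neq0.
rewrite mleadXm addmC; congr (_ + _)%MM; rewrite mlead_prod //.
apply/mnmP => j; rewrite mnm_sumE (bigD1 j) //= big1 ?addn0 => [|i ij].
  by rewrite mleadX ?node_factor_neq0 // mlead_node_factor !mulmnE mnm1E eqxx mul1n mulnC.
by rewrite mleadX ?node_factor_neq0 // mlead_node_factor !mulmnE mnm1E (negPf ij).
Qed.

Lemma prod_node_factor_coef0_neq0 (s : 'X_{1..n}) :
  (\prod_i node_factor i ^+ s i)@_0 != 0.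
Proof.
rewrite rmorph_prod; apply/prodf_neq0 => i _ /=; rewrite rmorphXn expf_neq0 //=.
rewrite /node_factor rmorph_prod; apply/prodf_neq0 => j _ /=.
by rewrite mcoeffB mcoeffX mcoeffC eqxx mulr1 mnm1_eq0 sub0r oppr_eq0 pnatr_eq0.
Qed.

End NodeProduct.

Arguments node_factor {R} m {n} i.
Arguments node_product {R} m {n} s t.

Lemma mult_ge_node_factor (m n : nat) (i : 'I_n) (c : 'I_n -> nat) :
  (0 < c i <= m)%N -> mult_ge (node_factor m i) (pt c) 1.
Proof.
case/andP=> c0 cm; have cm' : ((c i).-1 < m)%N by rewrite prednK.
rewrite /node_factor (bigD1 (Ordinal cm')) //= prednK //.
exact/mult_geMr/mult_ge_XsubC.
Qed.

Lemma mult_ge_node_product (m n : nat) (s t : 'X_{1..n}) (c : 'I_n -> nat) :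
  (forall i, (c i <= m)%N) ->
  mult_ge (node_product m s t) (pt c) (\sum_i if c i == 0%N then t i else s i).
Proof.
move=> cm; rewrite /node_product mpolyXE_id -big_split; apply: mult_ge_prod => i /=.
case: eqP => [ci|/eqP ci]; last first.
  rewrite mulrC -[X in mult_ge _ _ X]muln1; apply/mult_geMr/mult_geX/mult_ge_node_factor.
  by rewrite lt0n ci cm.
rewrite -[X in mult_ge _ _ X]muln1; apply/mult_geMr/mult_geX.
by rewrite -['X_i]subr0 -mpolyC0; apply: mult_ge_XsubC; rewrite /pt ci.
Qed.

Lemma mult_eq_node_productD (m n : nat) (s t : 'X_{1..n}) (Q : {mpoly RR[n]}) :
  mult_ge Q (@origin n) (mdeg t).+1 ->
  mult_eq (node_product m s t + Q) (@origin n) (mdeg t).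
Proof.
move=> /mult_ge_originP lowQ; split.
  apply/mult_ge_originP => g gt; rewrite mcoeffD (lowQ _ (ltnW gt)) addr0.
  rewrite /node_product mulrC mcoeffMX_sub ifN //.
  by apply: contraL gt => /submK <-; rewrite mdegD -leqNgt leq_addl.
move=> /mult_ge_originP/(_ t (ltnSn _))/eqP; apply/negP.
rewrite mcoeffD lowQ // addr0 /node_product mulrC -[X in _@_X]addm0 mcoeffMX.
exact: prod_node_factor_coef0_neq0.
Qed.

Lemma digit_order_bound (m a : nat) (nz : bool) :
  (a + nz <= m.+1 * (if nz then a.+1 %/ m.+1 else a - m * (a.+1 %/ m.+1)) + m)%N.
Proof.
set s := (_ %/ _)%N; have ub : (a.+1 < s.+1 * m.+1)%N by rewrite ltn_ceil.
have lb : (s * m.+1 <= a.+1)%N by rewrite leq_trunc_div.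
by case: nz; nia.
Qed.

Definition grid_flat (m n k : nat) (P : {mpoly RR[n]}) : Prop :=
  vanishes_grid m k P /\ mult_ge P (@origin n) (k - 1).

Lemma grid_flat_lin (m n k : nat) (c : RR) (P Q : {mpoly RR[n]}) :
  grid_flat m k P -> grid_flat m k Q -> grid_flat m k (c *: P + Q).
Proof.
move=> [vP oP] [vQ oQ]; split; last exact: mult_ge_lin.
by move=> a ha; apply: mult_ge_lin; [apply: vP|apply: vQ].
Qed.

Lemma mlead_grid_flat (m n k : nat) (g : 'X_{1..n}) : (0 < k)%N ->
  (m * n + m.+1 * (k - 1) <= mdeg g)%N ->
  exists G : {mpoly RR[n]}, [/\ grid_flat m k G, G != 0 & mlead G = g].
Proof.
move=> k0 deg_g.
(* Whenever [m * s i + t i = g i], the leading monomial of [node_product m s t] is [g];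
   this choice of [s] balances the order [s i] at the nonzero nodes and [t i] at 0. *)
pose s : 'X_{1..n} := [multinom ((g i).+1 %/ m.+1)%N | i < n].
pose t : 'X_{1..n} := [multinom (g i - m * s i)%N | i < n].
pose order (c : 'I_n -> nat) := (\sum_i if c i == 0%N then t i else s i)%N.
have orderP c : (m.+1 * (k - 1) + \sum_i (c i != 0%N) <= m.+1 * order c)%N.
  rewrite -(leq_add2l (m * n)) addnA (leq_trans (leq_add deg_g (leqnn _))) // mdegE.
  have -> : (m * n = \sum_(i < n) m)%N by rewrite sum_nat_const card_ord mulnC.
  rewrite big_distrr -!big_split /=.
  apply: leq_sum => i _; rewrite [X in (_ <= X)%N]addnC !mnmE.
  by have := digit_order_bound m (g i) (c i != 0%N); rewrite if_neg.
exists (node_product m s t); split; [split|exact: node_product_neq0|].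
- move=> c [cm [i ci]]; apply: mult_ge_leq (mult_ge_node_product cm).
  by have := orderP c; rewrite /order (bigD1 i) //= (introN eqP ci); nia.
- have -> : @origin n = pt (fun=> 0%N) by [].
  apply: mult_ge_leq (mult_ge_node_product _) => //.
  by have := orderP (fun=> 0%N); rewrite big1 // addn0 leq_pmul2l.
rewrite mlead_node_product; apply/mnmP => i; rewrite mnmDE mulmnE mulnC.
have -> : t i = (g i - m * s i)%N by rewrite mnmE.
rewrite subnKC // mnmE; have := leq_trunc_div (g i).+1 m.+1.
by rewrite mulnS; move: (_ %/ _)%N => q; nia.
Qed.

Lemma tdeg_node_product (m n : nat) (s t : 'X_{1..n}) :
  tdeg (node_product m s t) = (mdeg s * m + mdeg t)%N.
Proof.
by rewrite /tdeg -mlead_deg ?node_product_neq0 // mlead_node_product mdegD mdegMn.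
Qed.

Lemma grid_flat_reduction (m n k : nat) (P : {mpoly RR[n]}) : (0 < k)%N ->
  exists2 Q, grid_flat m k Q & (msize (P + Q) <= m * n + m.+1 * (k - 1))%N.
Proof.
move=> k0; apply: mlead_reduction => [|c Q1 Q2|g gD].
- by split=> [c _|]; apply: mult_ge_poly0.
- exact: grid_flat_lin.
- exact: mlead_grid_flat.
Qed.

Lemma order_pred_attained (m n k : nat) : (0 < n)%N -> (0 < k)%N ->
  exists P : {mpoly RR[n]},
    [/\ vanishes_grid m k P, mult_eq P (@origin n) (k - 1) &
        tdeg P = (m * n + m.+1 * (k - 1))%N].
Proof.
move=> n0 k0; pose t : 'X_{1..n} := (U_(Ordinal n0) *+ (k - 1))%MM.
have deg_t : mdeg t = (k - 1)%N by rewrite mdegMn mdeg1 mul1n.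
pose ones : 'X_{1..n} := [multinom 1%N | _ < n].
exists (node_product m (t + ones) t); split.
- move=> c [cm [i ci]]; apply: mult_ge_leq (mult_ge_node_product cm).
  rewrite (eq_bigr (fun j => t j + (c j != 0%N)))%N => [|j _]; last first.
    by rewrite mnmDE [ones j]mnmE; case: eqP; rewrite /= ?addn0.
  rewrite big_split /= -mdegE deg_t (bigD1 i) //= (introN eqP ci) addnA.
  by rewrite subnK // leq_addr.
- rewrite -[node_product _ _ _]addr0 -deg_t; apply: mult_eq_node_productD.
  exact: mult_ge_poly0.
rewrite tdeg_node_product mdegD deg_t [mdeg ones]mdegE.
under eq_bigr => i _ do rewrite mnmE.
by rewrite sum1_card card_ord; nia.
Qed.

Lemma low_order_attained (m n k l : nat) : (0 < n)%N -> (l < k - 1)%N ->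
  exists P : {mpoly RR[n]},
    [/\ vanishes_grid m k P, mult_eq P (@origin n) l &
        (tdeg P <= m * n + m.+1 * (k - 1) - 1)%N].
Proof.
move=> n0 lk; have k0 : (0 < k)%N by case: k lk.
pose t : 'X_{1..n} := (U_(Ordinal n0) *+ l)%MM.
have deg_t : mdeg t = l by rewrite mdegMn mdeg1 mul1n.
pose s : 'X_{1..n} := [multinom k | _ < n].
have [Q [vQ oQ] degQ] := grid_flat_reduction m (node_product m s t) k0.
exists (node_product m s t + Q); split.
- move=> c cnz; rewrite -[node_product _ _ _]scale1r; apply: mult_ge_lin (vQ _ cnz).
  case: cnz => cm [i ci]; apply: mult_ge_leq (mult_ge_node_product cm).
  by rewrite (bigD1 i) //= (introF eqP ci) mnmE leq_addr.
- by rewrite -deg_t; apply: mult_eq_node_productD; rewrite deg_t; apply: mult_ge_leq lk oQ.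
by rewrite /tdeg -subn1 leq_sub2r.
Qed.

Theorem theorem1p5 (m n k : nat) (hm : (0 < m)%N) (hn : (0 < n)%N) (hk : (2 <= k)%N) :
  (* (i) lower bound *)
  (forall (P : {mpoly RR[n]}),
      vanishes_grid m k P -> mult_eq P (@origin n) (k - 1) ->
      (m * n + m.+1 * (k - 1) <= tdeg P)%N) /\
  (* (ii) lower bound *)
  (forall (P : {mpoly RR[n]}) (l : nat),
      vanishes_grid m k P -> mult_eq P (@origin n) l ->
      (l <= k - 2)%N -> k \in [:: 2; 3; 4]%N -> (k - 1 <= n)%N ->
      (m * n + m.+1 * (k - 1) - 1 <= tdeg P)%N) /\
  (* sharpness of (i) *)
  (exists P : {mpoly RR[n]},
      [/\ vanishes_grid m k P, mult_eq P (@origin n) (k - 1) &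
          tdeg P = (m * n + m.+1 * (k - 1))%N]) /\
  (* sharpness of (ii) *)
  (k \in [:: 2; 3; 4]%N -> (k - 1 <= n)%N ->
   forall l : nat, (l <= k - 2)%N ->
   exists P : {mpoly RR[n]},
      [/\ vanishes_grid m k P, mult_eq P (@origin n) l &
          tdeg P = (m * n + m.+1 * (k - 1) - 1)%N]).
Proof.
have k0 : (0 < k)%N := ltnW hk.
have range : k \in [:: 2; 3; 4]%N -> (1 < k <= 4)%N by rewrite !inE => /or3P[] /eqP ->.
split; first by move=> P; apply: tdeg_ge_order_pred.
split; first by move=> P l van ord lk /range k4 kn; apply: tdeg_ge_low_order van ord lk kn.
split; first exact: order_pred_attained.
move=> /range k4 kn l lk; have lk1 : (l < k - 1)%N by rewrite (leq_ltn_trans lk) // ltn_sub2l.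
have [P [van ord degP]] := low_order_attained m hn lk1; exists P; split=> //.
by apply/eqP; rewrite eqn_leq degP (tdeg_ge_low_order hm k4 van ord lk kn).
Qed.
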